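(* Let $\alpha>1$ and $r=\frac12(1-\frac1\alpha)$. Let $a,b$ be positive integers with $a\le b$ and $s=a+b\ge 2$, and let $n_*=\lfloor -\log_r a\rfloor+1$. Then for every positive even integer $k$ with \[ k\ \ge\ \max\Bigg\{\left\lceil 2\,\frac{(1-r+r^{n_*})^{a-1}\,[\,b(1-r+r^{n_*})+a\,]}{(1-r)^{a-1}(1-r^{n_*})^{b-1}\,[\,b(1-r)+a(1-r^{n_*})\,]}+2\right\rceil\cdot\Big(\frac{1-r}{r}\Big)^{a},\ \ 2\Big(\frac{1-r}{r}\Big)^{a+1},\ \ 2\Big(\frac{1}{1-r}\Big)^{s-1}+2\Bigg\}, \] we have \[ \Big[0,\tfrac k2\Big]=\{x_1^ax_2^b+x_3^ax_4^b+\cdots+x_{k-1}^ax_k^b:\ x_1,\dots,x_k\in C_\alpha\}. \]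
   Context: For real $\alpha>1$ let $r=\frac12(1-\frac1\alpha)\in(0,\frac12)$. Define $f_0,f_1:[0,1]\to[0,1]$ by $f_0(x)=rx$, $f_1(x)=rx+1-r$; for $\omega=\sigma_1\cdots\sigma_n\in\{0,1\}^n$ let $f_\omega=f_{\sigma_1}\circ\cdots\circ f_{\sigma_n}$. Let $F_n=\{f_\omega([0,1]):\omega\in\{0,1\}^n\}$ (the level-$n$ basic intervals, each of length $r^n$), $C_n=\bigcup_{I\in F_n}I$, and $C_\alpha=\bigcap_{n\ge1}C_n$ (the middle-$\frac1\alpha$ Cantor set; $C_3$ is the ternary Cantor set). *)

(* Defs.v *)
From Stdlib Require Import Reals Lra Lia List.
Open Scope R_scope.

Definition ratio (alpha : R) : R := (1 - 1 / alpha) / 2.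

Definition f0 (alpha x : R) : R := ratio alpha * x.
Definition f1 (alpha x : R) : R := ratio alpha * x + 1 - ratio alpha.
Definition fsig (alpha : R) (b : bool) : R -> R := if b then f1 alpha else f0 alpha.

Definition fword (alpha : R) (w : list bool) (x : R) : R :=
  fold_right (fun b y => fsig alpha b y) x w.

Definition Clevel (alpha : R) (n : nat) (x : R) : Prop :=
  exists w : list bool, length w = n /\ exists y, 0 <= y <= 1 /\ x = fword alpha w y.

Definition Cantor (alpha : R) (x : R) : Prop :=
  forall n : nat, (1 <= n)%nat -> Clevel alpha n x.

Definition Rfloor (x : R) : Z := (up x - 1)%Z.
Definition Rceil (x : R) : Z := (- Rfloor (- x))%Z.

Definition logb (r x : R) : R := ln x / ln r.

Definition nstar (alpha : R) (a : nat) : nat :=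
  Z.to_nat (Rfloor (- logb (ratio alpha) (INR a)) + 1).

Fixpoint sumR (n : nat) (f : nat -> R) : R :=
  match n with O => 0 | S m => sumR m f + f m end.

Definition bound1 (alpha : R) (a b : nat) : R :=
  let r := ratio alpha in
  let N := nstar alpha a in
  IZR (Rceil (2 * ((1 - r + r ^ N) ^ (a - 1) * (INR b * (1 - r + r ^ N) + INR a))
               / ((1 - r) ^ (a - 1) * (1 - r ^ N) ^ (b - 1)
                  * (INR b * (1 - r) + INR a * (1 - r ^ N))) + 2))
  * ((1 - r) / r) ^ a.

Definition bound2 (alpha : R) (a : nat) : R :=
  let r := ratio alpha in 2 * ((1 - r) / r) ^ (a + 1).

Definition bound3 (alpha : R) (a b : nat) : R :=
  let r := ratio alpha in 2 * (1 / (1 - r)) ^ (a + b - 1) + 2.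

(* Main.v *)
Require Import Defs.
From Stdlib Require Import Reals Lra Lia List ZArith ClassicalEpsilon.
Open Scope R_scope.

(** The second factor is not needed: taking [x_2 = x_4 = ... = 1] it suffices that
    the sum of [m = k/2] copies of the powers [{x^a : x in C}] is [[0, m]].  This is a
    Newhouse-Astels thickness argument.  Keep [m] intervals whose sum of images under
    [x^a] contains the target, and split one of them by removing a gap; the target
    survives as soon as the gap is at most the total length of the other [m - 1] images.
    That is ensured by attaching to each interval a key that bounds its gap and all later
    gaps, by requiring both pieces to have length at least key/(m-1), and by always
    splitting an interval of maximal key.

    The usual binary tree of basic intervals does not admit such keys when [a] is large,
    since the gaps of [x^a] near 1 dwarf the image of the left piece [[0, r]].  So [[0, 1]]
    is first peeled from the right into basic intervals of level [N = nstar], through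
    hulls [[0, w]], down to [[0, r]], which is a scaled copy of [[0, 1]]; only the peeled
    intervals are split in the usual way.  As [r <= a r^N <= 1], the slope of [x^a] is
    nearly constant on a peeled interval, whose image is still long enough to serve. *)

(** * Finite sums and pointwise updates of families *)

Lemma sumR_le n f g : (forall i, (i < n)%nat -> f i <= g i) -> sumR n f <= sumR n g.
Proof.
  induction n as [|n IH]; intros H; simpl; [lra|].
  assert (sumR n f <= sumR n g) by (apply IH; intros; apply H; lia).
  specialize (H n ltac:(lia)); lra.
Qed.

Lemma sumR_ext n f g : (forall i, (i < n)%nat -> f i = g i) -> sumR n f = sumR n g.
Proof.
  intros H; apply Rle_antisym; apply sumR_le; intros i Hi; rewrite (H i Hi); lra.
Qed.

Lemma sumR_const n c : sumR n (fun _ => c) = INR n * c.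
Proof. induction n as [|n IH]; [simpl; lra|]. rewrite S_INR; simpl; lra. Qed.

Lemma sumR_minus n f g : sumR n (fun i => f i - g i) = sumR n f - sumR n g.
Proof. induction n as [|n IH]; simpl; lra. Qed.

Definition update {A : Type} (c : nat -> A) (i : nat) (x : A) (j : nat) : A :=
  if Nat.eq_dec j i then x else c j.

Lemma update_same {A : Type} (c : nat -> A) i x : update c i x i = x.
Proof. unfold update; destruct (Nat.eq_dec i i); congruence. Qed.

Lemma update_other {A : Type} (c : nat -> A) i x j : j <> i -> update c i x j = c j.
Proof. unfold update; destruct (Nat.eq_dec j i); congruence. Qed.

Lemma sumR_update {A : Type} n (h : A -> R) (c : nat -> A) i x : (i < n)%nat ->
  sumR n (fun j => h (update c i x j)) = sumR n (fun j => h (c j)) - h (c i) + h x.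
Proof.
  induction n as [|n IH]; intros Hi; [lia|]; simpl.
  destruct (Nat.eq_dec i n) as [->|Hne].
  - rewrite update_same.
    rewrite (sumR_ext n _ (fun j => h (c j))); [lra|].
    intros j Hj; rewrite update_other by lia; reflexivity.
  - rewrite IH by lia. rewrite update_other by lia. lra.
Qed.

Lemma max_index n (h : nat -> R) : (0 < n)%nat ->
  exists i, (i < n)%nat /\ forall j, (j < n)%nat -> h j <= h i.
Proof.
  induction n as [|n IH]; intros Hn; [lia|].
  destruct n as [|n].
  - exists 0%nat; split; [lia|]. intros j Hj; replace j with 0%nat by lia; lra.
  - destruct (IH ltac:(lia)) as [i [Hi Hmax]].
    destruct (Rle_dec (h i) (h (S n))) as [Hle|Hle].
    + exists (S n); split; [lia|]. intros j Hj.
      destruct (Nat.eq_dec j (S n)) as [->|]; [lra|].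
      specialize (Hmax j ltac:(lia)); lra.
    + exists i; split; [lia|]. intros j Hj.
      destruct (Nat.eq_dec j (S n)) as [->|]; [lra|].
      apply Hmax; lia.
Qed.

(** * The abstract splitting argument for a sum of [m] images *)

Record node := Node { lo : R; hi : R; key : R }.

Definition inside (B' B : node) : Prop := lo B <= lo B' /\ hi B' <= hi B.

(** The last two clauses make each piece shorter than [B] by at least [kappa * key B], measured
    before [phi] is applied; termination rests on them. *)
Definition splits (m : nat) (phi : R -> R) (kappa : R) (B B1 B2 : node) : Prop :=
  lo B1 = lo B /\ hi B2 = hi B /\ key B1 <= key B /\ key B2 <= key B /\
  phi (lo B2) - phi (hi B1) <= key B /\
  key B <= INR (m - 1) * (phi (hi B1) - phi (lo B1)) /\
  key B <= INR (m - 1) * (phi (hi B2) - phi (lo B2)) /\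
  hi B1 <= hi B - kappa * key B /\ lo B + kappa * key B <= lo B2.

Section Thick.
Variables (m : nat) (phi : R -> R) (valid : node -> Prop) (kappa M : R).
Hypothesis m_ge2 : (2 <= m)%nat.
Hypothesis kappa_pos : 0 < kappa.
Hypothesis M_pos : 0 < M.
Hypothesis phi_mono : forall x y, 0 <= x <= y -> phi x <= phi y.
Hypothesis valid_order : forall B, valid B -> 0 <= lo B <= hi B.
Hypothesis valid_key : forall B, valid B -> phi (hi B) - phi (lo B) <= M * key B.
Hypothesis valid_splits : forall B, valid B ->
  exists B1 B2, valid B1 /\ valid B2 /\ splits m phi kappa B B1 B2.

(* The second clause is the invariant that makes the gap of any interval of maximal key
   bridged by the remaining m - 1 ones. *)
Definition good (t : R) (c : nat -> node) : Prop :=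
  (forall i, (i < m)%nat -> valid (c i)) /\
  (forall i j, (i < m)%nat -> (j < m)%nat ->
     key (c i) <= INR (m - 1) * (phi (hi (c j)) - phi (lo (c j)))) /\
  sumR m (fun i => phi (lo (c i))) <= t <= sumR m (fun i => phi (hi (c i))).

Definition refines (c' c : nat -> node) : Prop :=
  forall i, (i < m)%nat -> inside (c' i) (c i).

(** The invariant survives because [key (c i)] separates the two sides: after the replacement every
    key is still at most this old maximum, and every image, old or new, has length at least
    [key (c i) / (m - 1)]. *)
Lemma good_update t c i B :
  good t c -> (i < m)%nat -> valid B -> key B <= key (c i) ->
  (forall j, (j < m)%nat -> key (c j) <= key (c i)) ->
  key (c i) <= INR (m - 1) * (phi (hi B) - phi (lo B)) ->
  sumR m (fun j => phi (lo (c j))) - phi (lo (c i)) + phi (lo B) <= t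
    <= sumR m (fun j => phi (hi (c j))) - phi (hi (c i)) + phi (hi B) ->
  good t (update c i B).
Proof.
  intros [Hv [Hk _]] Hi HB Hkey Hmax Hlen Ht.
  split; [|split].
  - intros j Hj. destruct (Nat.eq_dec j i) as [->|Hne];
      [rewrite update_same | rewrite update_other by auto]; auto.
  - assert (Hk' : forall j, (j < m)%nat -> key (update c i B j) <= key (c i)).
    { intros j Hj. destruct (Nat.eq_dec j i) as [->|Hne];
        [rewrite update_same | rewrite update_other by auto]; auto. }
    intros j j' Hj Hj'.
    apply Rle_trans with (key (c i)); [auto|].
    destruct (Nat.eq_dec j' i) as [->|Hne];
      [rewrite update_same | rewrite update_other by auto]; auto.
  - rewrite (sumR_update m (fun B => phi (lo B))) by auto.
    rewrite (sumR_update m (fun B => phi (hi B))) by auto. exact Ht.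
Qed.

(** Replacing [c i] by [B1] or by [B2] gives two ranges of sums with no hole between them: the gap
    is at most [key (c i)], and the other [m - 1] images have at least that total length. *)
Lemma good_step t c i :
  good t c -> (i < m)%nat -> (forall j, (j < m)%nat -> key (c j) <= key (c i)) ->
  exists c', good t c' /\ refines c' c /\
    sumR m (fun j => hi (c' j) - lo (c' j))
      <= sumR m (fun j => hi (c j) - lo (c j)) - kappa * key (c i).
Proof.
  intros Hg Hi Hmax. pose proof Hg as [Hv [Hk Ht]].
  destruct (valid_splits _ (Hv i Hi)) as
    [B1 [B2 [V1 [V2 [Elo [Ehi [K1 [K2 [Gap [L1 [L2 [S1 S2]]]]]]]]]]]].
  pose proof (valid_order _ V1) as O1. pose proof (valid_order _ V2) as O2.
  pose proof (valid_order _ (Hv i Hi)) as O.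
  assert (Hm1 : 1 <= INR (m - 1)) by (apply (le_INR 1); lia).
  assert (Kpos : 0 <= key (c i)).
  { pose proof (valid_key _ (Hv i Hi)).
    pose proof (phi_mono _ _ O). destruct (Rle_dec 0 (key (c i))); auto. nra. }
  assert (Hrest : key (c i) <=
     (sumR m (fun j => phi (hi (c j))) - phi (hi (c i))) -
     (sumR m (fun j => phi (lo (c j))) - phi (lo (c i)))).
  (* [e] is the length that the invariant grants to each other image; slot [i] is set to 0 so that
     only those are summed. *)
  { set (e := key (c i) / INR (m - 1)).
    assert (He : sumR m (fun j => update (fun _ => e) i 0 j) <=
                 sumR m (fun j => update (fun j => phi (hi (c j)) - phi (lo (c j))) i 0 j)).
    { apply sumR_le; intros j Hj.
      destruct (Nat.eq_dec j i) as [->|Hne];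
        [rewrite !update_same; lra | rewrite !update_other by auto].
      unfold e. specialize (Hk i j Hi Hj).
      apply Rmult_le_reg_l with (INR (m - 1)); [lra|].
      replace (INR (m - 1) * (key (c i) / INR (m - 1))) with (key (c i)) by (field; lra).
      lra. }
    rewrite (sumR_update m (fun x => x)) in He by auto.
    rewrite (sumR_update m (fun x => x)) in He by auto.
    rewrite sumR_const, sumR_minus in He.
    replace (INR m * e - e + 0) with (key (c i)) in He; [lra|].
    rewrite minus_INR in * by lia. unfold e. rewrite minus_INR by lia.
    simpl INR in *. field. lra. }
  assert (Hkk : 0 <= kappa * key (c i)) by (apply Rmult_le_pos; lra).
  destruct (Rle_dec t (sumR m (fun j => phi (hi (c j))) - phi (hi (c i)) + phi (hi B1)))
    as [Hle|Hgt].
  - exists (update c i B1). split; [|split].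
    + apply good_update; auto. rewrite Elo. split; lra.
    + intros j Hj. destruct (Nat.eq_dec j i) as [->|Hne];
        [rewrite update_same | rewrite update_other by auto]; split; lra.
    + rewrite (sumR_update m (fun B => hi B - lo B)) by auto. lra.
  - exists (update c i B2). split; [|split].
    + apply good_update; auto. rewrite Ehi. split; lra.
    + intros j Hj. destruct (Nat.eq_dec j i) as [->|Hne];
        [rewrite update_same | rewrite update_other by auto]; split; lra.
    + rewrite (sumR_update m (fun B => hi B - lo B)) by auto. lra.
Qed.

(** While some key exceeds [eps], splitting an interval of maximal key lowers the total length by at
    least [kappa * eps]. This length stays nonnegative, so the process stops; the induction is on
    the number of steps that the initial length allows. *)
Lemma good_refine t eps : 0 < eps -> forall c, good t c ->
  exists c', good t c' /\ refines c' c /\ forall i, (i < m)%nat -> key (c' i) <= eps.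
Proof.
  intros Heps.
  assert (Hn : forall n c, good t c ->
    sumR m (fun j => hi (c j) - lo (c j)) <= INR n * (kappa * eps) ->
    exists c', good t c' /\ refines c' c /\ forall i, (i < m)%nat -> key (c' i) <= eps).
  { assert (Hke : 0 < kappa * eps) by (apply Rmult_lt_0_compat; auto).
    assert (Hpos : forall c, good t c -> 0 <= sumR m (fun j => hi (c j) - lo (c j))).
    { intros c [Hv _]. rewrite <- (Rmult_0_r (INR m)), <- sumR_const.
      apply sumR_le; intros j Hj. pose proof (valid_order _ (Hv j Hj)); lra. }
    induction n as [|n IH]; intros c Hg Hsum;
      destruct (max_index m (fun i => key (c i)) ltac:(lia)) as [i [Hi Hmax]];
      (destruct (Rle_dec (key (c i)) eps) as [Hle|Hgt];
       [exists c; split; [auto|split; [intros j Hj; split; lra|]];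
        intros j Hj; specialize (Hmax j Hj); simpl in Hmax; lra|]);
      destruct (good_step t c i Hg Hi Hmax) as [c' [Hg' [Hr Hs]]];
      assert (kappa * eps <= kappa * key (c i)) by (apply Rmult_le_compat_l; lra).
    - pose proof (Hpos _ Hg'). simpl in Hsum. lra.
    - rewrite S_INR in Hsum. destruct (IH c' Hg') as [c'' [Hg'' [Hr' Hk]]]; [lra|].
      exists c''; split; [auto|split; [|auto]].
      intros j Hj. destruct (Hr j Hj), (Hr' j Hj). split; lra. }
  intros c Hg.
  destruct (INR_unbounded (sumR m (fun j => hi (c j) - lo (c j)) / (kappa * eps))) as [n Hnn].
  apply (Hn n c Hg). assert (0 < kappa * eps) by (apply Rmult_lt_0_compat; auto).
  replace (sumR m (fun j => hi (c j) - lo (c j))) with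
    (sumR m (fun j => hi (c j) - lo (c j)) / (kappa * eps) * (kappa * eps)) by (field; split; lra).
  apply Rmult_le_compat_r; lra.
Qed.

(** Refining repeatedly with [eps = 1/(n+1)] gives nested intervals, and [x i] is the supremum of
    their left ends. By [valid_key], vanishing keys mean vanishing image lengths, which squeezes the
    sum of the [phi (x i)] onto [t]. *)
Lemma good_limit t c : good t c ->
  exists x : nat -> R, t = sumR m (fun i => phi (x i)) /\
    forall i, (i < m)%nat -> forall eps, 0 < eps ->
      exists B, valid B /\ Rabs (x i - lo B) < eps.
Proof.
  intros Hg.
  (* Dependent choice: each family travels with its proof of [good], so that [next] can be
     iterated. *)
  pose (next (n : nat) (c : {c | good t c}) :=
    constructive_indefinite_description _
      (good_refine t (/ INR (S n)) (Rinv_0_lt_compat _ (lt_0_INR _ (Nat.lt_0_succ n)))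
         (proj1_sig c) (proj2_sig c))).
  pose (cs := nat_rect (fun _ => {c | good t c}) (exist _ c Hg)
    (fun n c => exist _ (proj1_sig (next n c)) (proj1 (proj2_sig (next n c))))).
  pose (b n := proj1_sig (cs n)).
  assert (Hgood : forall n, good t (b n)) by (intros n; exact (proj2_sig (cs n))).
  assert (Hnext : forall n, refines (b (S n)) (b n) /\
      forall i, (i < m)%nat -> key (b (S n) i) <= / INR (S n)).
  { intros n. exact (proj2 (proj2_sig (next n (cs n)))). }
  assert (Hmono : forall i p n, (i < m)%nat -> inside (b (p + n)%nat i) (b n i)).
  { intros i p n Hi. induction p as [|p IH]; [split; simpl; lra|].
    destruct (proj1 (Hnext (p + n)%nat) i Hi), IH. split; simpl; lra. }
  assert (Hlohi : forall i p n, (i < m)%nat -> lo (b p i) <= hi (b n i)).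
  { intros i p n Hi. destruct (Nat.le_ge_cases p n) as [Hle|Hle].
    - destruct (Hmono i (n - p)%nat p Hi) as [H _].
      replace (n - p + p)%nat with n in H by lia.
      pose proof (valid_order _ (proj1 (Hgood n) i Hi)). lra.
    - destruct (Hmono i (p - n)%nat n Hi) as [_ H].
      replace (p - n + n)%nat with p in H by lia.
      pose proof (valid_order _ (proj1 (Hgood p) i Hi)). lra. }
  assert (Hx : forall i, exists x, (i < m)%nat ->
     is_lub (fun y => exists n, y = lo (b n i)) x).
  { intros i. destruct (Compare_dec.lt_dec i m) as [Hi|Hi]; [|exists 0; intros; lia].
    destruct (completeness (fun y => exists n, y = lo (b n i))) as [x Hx].
    - exists (hi (b 0%nat i)). intros y [n ->]. auto.
    - exists (lo (b 0%nat i)). exists 0%nat; reflexivity.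
    - exists x; auto. }
  pose (x i := proj1_sig (constructive_indefinite_description _ (Hx i))).
  assert (Hlub : forall i, (i < m)%nat -> is_lub (fun y => exists n, y = lo (b n i)) (x i)).
  { intros i. exact (proj2_sig (constructive_indefinite_description _ (Hx i))). }
  assert (Hin : forall i n, (i < m)%nat -> lo (b n i) <= x i <= hi (b n i)).
  { intros i n Hi. destruct (Hlub i Hi) as [Hub Hleast]. split.
    - apply Hub; exists n; reflexivity.
    - apply Hleast. intros y [p ->]; auto. }
  exists x. split.
  - assert (Hclose : forall n, Rabs (t - sumR m (fun i => phi (x i)))
                               <= INR m * M * / INR (S n)).
    { intros n. destruct (Hgood (S n)) as [Hv [_ Ht]].
      assert (sumR m (fun i => phi (lo (b (S n) i))) <= sumR m (fun i => phi (x i))).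
      { apply sumR_le; intros i Hi. apply phi_mono.
        pose proof (valid_order _ (Hv i Hi)). pose proof (Hin i (S n) Hi). lra. }
      assert (sumR m (fun i => phi (x i)) <= sumR m (fun i => phi (hi (b (S n) i)))).
      { apply sumR_le; intros i Hi. apply phi_mono.
        pose proof (valid_order _ (Hv i Hi)). pose proof (Hin i (S n) Hi). lra. }
      assert (sumR m (fun i => phi (hi (b (S n) i)) - phi (lo (b (S n) i)))
              <= INR m * (M * / INR (S n))).
      { rewrite <- sumR_const. apply sumR_le; intros i Hi.
        eapply Rle_trans; [apply valid_key; auto|].
        apply Rmult_le_compat_l; [lra|]. apply (proj2 (Hnext n)); auto. }
      rewrite sumR_minus in *. apply Rabs_le. lra. }
    destruct (Req_dec t (sumR m (fun i => phi (x i)))) as [|Hne]; [auto|exfalso].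
    assert (Hd : 0 < Rabs (t - sumR m (fun i => phi (x i)))) by (apply Rabs_pos_lt; lra).
    set (e := Rabs _) in *.
    destruct (INR_unbounded (INR m * M / e)) as [n Hn].
    specialize (Hclose n).
    assert (0 < INR (S n)) by (apply lt_0_INR; lia).
    assert (INR m * M < INR n * e).
    { replace (INR m * M) with (INR m * M / e * e) by (field; lra).
      apply Rmult_lt_compat_r; auto. }
    assert (e * INR (S n) <= INR m * M).
    { replace (INR m * M) with (INR m * M * / INR (S n) * INR (S n)) by (field; lra).
      apply Rmult_le_compat_r; lra. }
    rewrite S_INR in *. lra.
  - intros i Hi eps Heps. destruct (Hlub i Hi) as [Hub Hleast].
    destruct (excluded_middle_informative (exists n, x i - eps < lo (b n i))) as [[n Hn]|Hno].
    + exists (b n i). split; [apply (Hgood n); auto|].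
      pose proof (Hin i n Hi). apply Rabs_def1; lra.
    + exfalso. assert (x i <= x i - eps); [|lra].
      apply Hleast. intros y [n ->].
      destruct (Rle_dec (lo (b n i)) (x i - eps)) as [|Hc]; [auto|].
      exfalso; apply Hno; exists n; lra.
Qed.

Lemma thick_sum B t : valid B ->
  key B <= INR (m - 1) * (phi (hi B) - phi (lo B)) ->
  INR m * phi (lo B) <= t <= INR m * phi (hi B) ->
  exists x : nat -> R, t = sumR m (fun i => phi (x i)) /\
    forall i, (i < m)%nat -> forall eps, 0 < eps ->
      exists B, valid B /\ Rabs (x i - lo B) < eps.
Proof.
  intros HB Hk Ht. apply (good_limit t (fun _ => B)).
  split; [auto|split; [auto|]]. rewrite !sumR_const. exact Ht.
Qed.

End Thick.

(** * Left end points of basic intervals *)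

(** These are the points [f_w(0)] with [w] a word of length [n]; the basic interval is
    [[u, u + r^n]]. The constructors add the outermost map, whereas splitting an interval adds an
    innermost one, so the two children of an interval are found by induction. *)
Inductive left_end (r : R) : nat -> R -> Prop :=
| left_end_root : left_end r 0 0
| left_end_f0 n u : left_end r n u -> left_end r (S n) (r * u)
| left_end_f1 n u : left_end r n u -> left_end r (S n) (r * u + 1 - r).

Section LeftEnd.
Variable r : R.
Hypothesis r_pos : 0 < r.
Hypothesis r_half : r < 1 / 2.

Lemma left_end_bounds n u : left_end r n u -> 0 <= u /\ u + r ^ n <= 1.
Proof. induction 1; simpl; [lra| |]; nra. Qed.

Lemma left_end_lower n u : left_end r n u -> left_end r (S n) u.
Proof.
  induction 1.
  - replace 0 with (r * 0) by ring. repeat constructor.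
  - constructor; auto.
  - apply (left_end_f1 r (S n)); auto.
Qed.

Lemma left_end_upper n u : left_end r n u -> left_end r (S n) (u + r ^ n - r * r ^ n).
Proof.
  induction 1.
  - replace (0 + r ^ 0 - r * r ^ 0) with (r * 0 + 1 - r) by (simpl; ring). repeat constructor.
  - replace (r * u + r ^ S n - r * r ^ S n) with (r * (u + r ^ n - r * r ^ n)) by (simpl; ring).
    constructor; auto.
  - replace (r * u + 1 - r + r ^ S n - r * r ^ S n)
      with (r * (u + r ^ n - r * r ^ n) + 1 - r) by (simpl; ring).
    apply (left_end_f1 r (S n)); auto.
Qed.

Lemma left_end_top n : left_end r n (1 - r ^ n).
Proof.
  induction n as [|n IH]; simpl.
  - replace (1 - 1) with 0 by ring. constructor.
  - replace (1 - r * r ^ n) with (r * (1 - r ^ n) + 1 - r) by ring. constructor; auto.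
Qed.

(** Gaps between neighbours are widest in the middle of [[0, 1]], where they measure [1 - 2 * r];
    inside either half they are scaled by [r]. *)
Lemma left_end_pred n u : left_end r n u ->
  u = 0 \/ exists u', left_end r n u' /\ 0 <= u - (u' + r ^ n) <= 1 - 2 * r.
Proof.
  induction 1 as [|n u Hu [->|[u' [Hu' Hd]]]|n u Hu [->|[u' [Hu' Hd]]]].
  - auto.
  - left; ring.
  - right; exists (r * u'); split; [constructor; auto|]. simpl; nra.
  (* Here [[1 - r, ...]] starts the right half, and its neighbour is the last interval of the left
     half, ending at [r]. *)
  - right; exists (r * (1 - r ^ n)); split; [constructor; apply left_end_top|].
    simpl; nra.
  - right; exists (r * u' + 1 - r); split; [constructor; auto|]. simpl; nra.
Qed.

End LeftEnd.

(** * The levels of the Cantor set: membership and closedness *)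

Lemma ratio_bounds alpha : 1 < alpha -> 0 < ratio alpha < 1 / 2.
Proof.
  intros H. unfold ratio.
  assert (0 < 1 / alpha < 1); [|lra].
  unfold Rdiv. rewrite Rmult_1_l. split; [apply Rinv_0_lt_compat; lra|].
  rewrite <- Rinv_1. apply Rinv_lt_contravar; lra.
Qed.

Lemma Clevel_fsig alpha n b y : Clevel alpha n y -> Clevel alpha (S n) (fsig alpha b y).
Proof.
  intros [w [Hw [z [Hz ->]]]]. exists (b :: w). split; [simpl; lia|].
  exists z. auto.
Qed.

Lemma Clevel_inv alpha n y : Clevel alpha (S n) y ->
  exists b z, Clevel alpha n z /\ y = fsig alpha b z.
Proof.
  intros [[|b w] [Hw [z [Hz ->]]]]; [discriminate|].
  exists b, (fword alpha w z). split; [|reflexivity].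
  exists w; split; [simpl in Hw; lia|]. exists z; auto.
Qed.

Lemma Clevel_0 alpha y : 0 <= y <= 1 <-> Clevel alpha 0 y.
Proof.
  split.
  - intros H. exists nil; split; [reflexivity|]. exists y; auto.
  - intros [[|] [Hw [z [Hz ->]]]]; [exact Hz|discriminate].
Qed.

(** Since [f0] fixes 0, a word that is too short can be prolonged by zeros, so a left end lies in
    every level. *)
Lemma left_end_Clevel alpha n u N : 1 < alpha ->
  left_end (ratio alpha) n u -> Clevel alpha N u.
Proof.
  intros Ha. pose proof (ratio_bounds _ Ha) as [Hr Hr2].
  revert n u. induction N as [|N IH]; intros n u H.
  - apply Clevel_0. pose proof (left_end_bounds _ Hr Hr2 _ _ H).
    pose proof (pow_lt _ n Hr). lra.
  - inversion H as [|n' u' H'|n' u' H']; subst.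
    + replace 0 with (fsig alpha false 0) by (unfold fsig, f0; ring).
      apply Clevel_fsig. apply (IH 0%nat). constructor.
    + apply (Clevel_fsig alpha N false). eauto.
    + apply (Clevel_fsig alpha N true). eauto.
Qed.

(** One of the two maps alone must supply arbitrarily good approximations of [x]; pulling back by
    its inverse lowers the level. *)
Lemma Clevel_closed alpha n x : 1 < alpha ->
  (forall eps, 0 < eps -> exists y, Clevel alpha n y /\ Rabs (x - y) < eps) ->
  Clevel alpha n x.
Proof.
  intros Ha. pose proof (ratio_bounds _ Ha) as [Hr Hr2]. revert x.
  induction n as [|n IH]; intros x H.
  - apply Clevel_0. split.
    + destruct (Rle_dec 0 x) as [|Hc]; [auto|].
      destruct (H (- x) ltac:(lra)) as [y [Hy Hd]].
      apply Clevel_0 in Hy. apply Rabs_def2 in Hd. lra.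
    + destruct (Rle_dec x 1) as [|Hc]; [auto|].
      destruct (H (x - 1) ltac:(lra)) as [y [Hy Hd]].
      apply Clevel_0 in Hy. apply Rabs_def2 in Hd. lra.
  - assert (Hb : exists b, forall eps, 0 < eps ->
        exists z, Clevel alpha n z /\ Rabs (x - fsig alpha b z) < eps).
    { destruct (excluded_middle_informative (forall eps, 0 < eps ->
        exists z, Clevel alpha n z /\ Rabs (x - fsig alpha true z) < eps)) as [|Hno];
        [exists true; auto|].
      exists false. intros eps Heps.
      apply Classical_Pred_Type.not_all_ex_not in Hno. destruct Hno as [e He].
      apply Classical_Prop.imply_to_and in He. destruct He as [He Hne].
      destruct (H (Rmin e eps) (Rmin_pos _ _ He Heps)) as [y [Hy Hd]].
      destruct (Clevel_inv _ _ _ Hy) as [[|] [z [Hz ->]]].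
      - exfalso; apply Hne. exists z; split; auto.
        pose proof (Rmin_l e eps); lra.
      - exists z; split; auto. pose proof (Rmin_r e eps); lra. }
    destruct Hb as [b Hb].
    set (s := if b then 1 - ratio alpha else 0).
    assert (Hs : forall z, fsig alpha b z = ratio alpha * z + s).
    { intros z; unfold s, fsig, f0, f1; destruct b; ring. }
    replace x with (fsig alpha b ((x - s) / ratio alpha)) by (rewrite Hs; field; lra).
    apply Clevel_fsig, IH. intros eps Heps.
    destruct (Hb (ratio alpha * eps)) as [z [Hz Hd]]; [nra|].
    exists z; split; auto. rewrite Hs in Hd.
    replace (x - (ratio alpha * z + s))
      with (ratio alpha * ((x - s) / ratio alpha - z)) in Hd by (field; lra).
    rewrite Rabs_mult, (Rabs_pos_eq (ratio alpha)) in Hd by lra.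
    apply Rmult_lt_reg_l with (ratio alpha); auto.
Qed.

Lemma Cantor_unit alpha x : 1 < alpha -> Cantor alpha x -> 0 <= x <= 1.
Proof.
  intros Ha H. pose proof (ratio_bounds _ Ha) as [Hr Hr2].
  destruct (Clevel_inv _ _ _ (H 1%nat (le_n _))) as [b [z [Hz ->]]].
  apply Clevel_0 in Hz. unfold fsig, f0, f1; destruct b; nra.
Qed.

Lemma Cantor_1 alpha : Cantor alpha 1.
Proof.
  intros n _. induction n as [|n IH]; [apply Clevel_0; lra|].
  replace 1 with (fsig alpha true 1) by (unfold fsig, f1; ring).
  apply Clevel_fsig; auto.
Qed.

(** * Mean value bounds for powers *)

Lemma pow_unit x n : 0 <= x <= 1 -> 0 <= x ^ n <= 1.
Proof.
  intros H. split; [apply pow_le; lra|]. rewrite <- (pow1 n); apply pow_incr; lra.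
Qed.

Lemma pow_diff_upper p x y : 0 <= x <= y ->
  y ^ S p - x ^ S p <= INR (S p) * (y - x) * y ^ p.
Proof.
  intros H. induction p as [|p IH]; [simpl; lra|].
  rewrite S_INR. replace (y ^ S (S p) - x ^ S (S p))
    with (y * (y ^ S p - x ^ S p) + (y - x) * x ^ S p) by (simpl; ring).
  assert (x ^ S p <= y ^ S p) by (apply pow_incr; lra).
  assert (y * (y ^ S p - x ^ S p) <= y * (INR (S p) * (y - x) * y ^ p))
    by (apply Rmult_le_compat_l; lra).
  assert ((y - x) * x ^ S p <= (y - x) * y ^ S p) by (apply Rmult_le_compat_l; lra).
  replace ((INR (S p) + 1) * (y - x) * y ^ S p)
    with (y * (INR (S p) * (y - x) * y ^ p) + (y - x) * y ^ S p) by (simpl (y ^ S p); ring).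
  lra.
Qed.

Lemma pow_diff_lower p x y : 0 <= x <= y ->
  INR (S p) * (y - x) * x ^ p <= y ^ S p - x ^ S p.
Proof.
  intros H. induction p as [|p IH]; [simpl; lra|].
  rewrite S_INR. replace (y ^ S (S p) - x ^ S (S p))
    with (x * (y ^ S p - x ^ S p) + (y - x) * y ^ S p) by (simpl; ring).
  assert (x ^ S p <= y ^ S p) by (apply pow_incr; lra).
  assert (x * (INR (S p) * (y - x) * x ^ p) <= x * (y ^ S p - x ^ S p))
    by (apply Rmult_le_compat_l; lra).
  assert ((y - x) * x ^ S p <= (y - x) * y ^ S p) by (apply Rmult_le_compat_l; lra).
  replace ((INR (S p) + 1) * (y - x) * x ^ S p)
    with (x * (INR (S p) * (y - x) * x ^ p) + (y - x) * x ^ S p) by (simpl (x ^ S p); ring).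
  lra.
Qed.

(** * The tree of intervals for the map [x^(p+1)] *)

Section Tree.
Variables (r : R) (p N m : nat).
(** Here [a = p + 1] and [nstar = N + 1]. A peeled interval has length [R0]; [A] is its length times
    [a], [Q] bounds the variation of the slope on it, and [q] bounds the ratio of the two sides of a
    gap between hulls. *)
Let R0 := r ^ S N.
Let A := INR (S p) * R0.
Let q := (1 - r) / r.
Let Q := (1 + R0 / (1 - r)) ^ p.
Hypothesis r_pos : 0 < r.
Hypothesis r_half : r < 1 / 2.
Hypothesis A_bounds : r <= A <= 1.
Hypothesis m_large1 : q ^ S p <= INR m.
Hypothesis m_large2 : 1 <= (INR m - 1) * r.
Hypothesis m_large3 : (1 - 2 * r) / r * q ^ p * Q <= INR m - 1.

Definition theta := 1 - / q ^ S p.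
(** For the hull [[0, v + R0]]: the first term bounds the gap to the left of [v], by [hull_gap]; the
    second is the key of the peeled interval [[v, v + R0]]. *)
Definition hull_key v := Rmax (theta * v ^ S p) ((1 - 2 * r) * A * (v + R0) ^ p).

Lemma q_ge1 : 1 <= q.
Proof. unfold q. apply Rmult_le_reg_r with r; auto. field_simplify; lra. Qed.

Lemma r_q : r * q = 1 - r.
Proof. unfold q; field; lra. Qed.

Lemma R0_bounds : 0 < R0 <= r.
Proof.
  unfold R0; simpl. assert (0 < r ^ N) by (apply pow_lt; auto).
  pose proof (pow_unit r N ltac:(lra)). nra.
Qed.

Lemma Q_ge1 : 1 <= Q.
Proof.
  unfold Q. apply pow_R1_Rle. destruct R0_bounds.
  assert (0 < R0 / (1 - r)) by (apply Rdiv_lt_0_compat; lra). lra.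
Qed.

Lemma m_minus1 : INR (m - 1) = INR m - 1.
Proof.
  rewrite minus_INR; [reflexivity|]. apply INR_le. simpl. nra.
Qed.

Lemma theta_bounds : 0 <= theta < 1.
Proof.
  unfold theta. pose proof q_ge1.
  assert (1 <= q ^ S p) by (apply pow_R1_Rle; auto).
  assert (0 < / q ^ S p) by (apply Rinv_0_lt_compat; lra).
  assert (/ q ^ S p <= / 1) by (apply Rinv_le_contravar; lra). rewrite Rinv_1 in *. lra.
Qed.

Lemma node_ratio v : 1 - r <= v -> (v + R0) ^ p <= Q * v ^ p.
Proof.
  intros Hv. unfold Q. rewrite <- Rpow_mult_distr. destruct R0_bounds.
  apply pow_incr. split; [lra|].
  assert (R0 <= R0 / (1 - r) * v); [|lra].
  assert (0 < R0 / (1 - r)) by (apply Rdiv_lt_0_compat; lra).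
  replace R0 with (R0 / (1 - r) * (1 - r)) at 1 by (field; lra).
  apply Rmult_le_compat_l; lra.
Qed.

Lemma m_large4 : (1 - 2 * r) * Q <= (INR m - 1) * r.
Proof.
  assert (Hq : 1 <= q ^ p) by (apply pow_R1_Rle, q_ge1). pose proof Q_ge1.
  apply Rle_trans with ((1 - 2 * r) / r * q ^ p * Q * r);
    [|apply Rmult_le_compat_r; lra].
  replace ((1 - 2 * r) / r * q ^ p * Q * r) with ((1 - 2 * r) * Q * q ^ p) by (field; lra).
  assert (0 <= (1 - 2 * r) * Q) by (apply Rmult_le_pos; lra). nra.
Qed.

Lemma hull_key_le1 v : 0 <= v -> v + R0 <= 1 -> hull_key v <= 1.
Proof.
  intros Hv Hw. destruct R0_bounds. pose proof theta_bounds. apply Rmax_lub.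
  - pose proof (pow_unit v (S p) ltac:(lra)). nra.
  - pose proof (pow_unit (v + R0) p ltac:(lra)).
    assert (0 <= (1 - 2 * r) * A <= 1) by nra. nra.
Qed.

Lemma hull_key_mono v v' : 0 <= v' <= v -> hull_key v' <= hull_key v.
Proof.
  intros H. destruct R0_bounds. pose proof theta_bounds. apply Rmax_lub.
  - eapply Rle_trans; [|apply Rmax_l]. apply Rmult_le_compat_l; [lra|].
    apply pow_incr; lra.
  - eapply Rle_trans; [|apply Rmax_r]. apply Rmult_le_compat_l; [nra|].
    apply pow_incr; lra.
Qed.

Lemma pow_le_q v w : 0 <= v <= q * w -> v ^ S p <= q ^ S p * w ^ S p.
Proof. intros H. rewrite <- Rpow_mult_distr. apply pow_incr; lra. Qed.

Lemma hull_gap v w : 0 <= v <= q * w -> v ^ S p - w ^ S p <= theta * v ^ S p.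
Proof.
  intros H. pose proof (pow_le_q _ _ H). unfold theta.
  assert (0 < q ^ S p) by (apply pow_lt; pose proof q_ge1; lra).
  assert (/ q ^ S p * v ^ S p <= w ^ S p); [|lra].
  apply Rmult_le_reg_l with (q ^ S p); auto.
  rewrite <- Rmult_assoc, Rinv_r by lra. lra.
Qed.

(** For the first term, [theta * q^a = q^a - 1 <= m - 1]. For the second,
    [(v + R0)^p <= Q * q^p * w^p] and [A <= 1] reduce the claim to [m_large3], with
    [r * w^p <= w^(p+1)]. *)
Lemma hull_left_bridge v w : 1 - r <= v -> r <= w <= 1 -> v <= q * w ->
  hull_key v <= INR (m - 1) * w ^ S p.
Proof.
  intros Hv Hw Hq. rewrite m_minus1. pose proof theta_bounds.
  assert (Hw1 : 0 < w ^ S p) by (apply pow_lt; lra).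
  assert (Hw0 : 0 < w ^ p) by (apply pow_lt; lra).
  assert (Hqp : 0 < q ^ S p) by (apply pow_lt; pose proof q_ge1; lra).
  apply Rmax_lub.
  - apply Rle_trans with (theta * (q ^ S p * w ^ S p)).
    + apply Rmult_le_compat_l; [lra|]. apply pow_le_q; lra.
    + replace (theta * (q ^ S p * w ^ S p)) with ((q ^ S p - 1) * w ^ S p)
        by (unfold theta; field; lra).
      apply Rmult_le_compat_r; lra.
  - pose proof (node_ratio v Hv).
    assert (v ^ p <= q ^ p * w ^ p)
      by (rewrite <- Rpow_mult_distr; apply pow_incr; lra).
    pose proof Q_ge1.
    assert ((v + R0) ^ p <= Q * (q ^ p * w ^ p)).
    { eapply Rle_trans; [apply node_ratio; auto|]. apply Rmult_le_compat_l; lra. }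
    assert (0 <= (v + R0) ^ p) by (apply pow_le; destruct R0_bounds; lra).
    apply Rle_trans with ((1 - 2 * r) * 1 * (Q * (q ^ p * w ^ p))).
    { apply Rmult_le_compat; try lra; nra. }
    apply Rle_trans with ((1 - 2 * r) / r * q ^ p * Q * (r * w ^ p)).
    { apply Req_le; field; lra. }
    apply Rle_trans with ((INR m - 1) * (r * w ^ p)).
    { apply Rmult_le_compat_r; [nra|auto]. }
    apply Rmult_le_compat_l; [nra|]. simpl. nra.
Qed.

(** The child [[u, u + r * l]] has slope at least [a * u^p], and [(v + R0)^p <= Q * u^p], so
    [m_large4] suffices. *)
Lemma basic_bridge v u l : 1 - r <= v <= u -> 0 < l ->
  (1 - 2 * r) * INR (S p) * l * (v + R0) ^ p
    <= INR (m - 1) * ((u + r * l) ^ S p - u ^ S p).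
Proof.
  intros Hv Hl. rewrite m_minus1.
  assert (Hm : 0 < INR m - 1) by nra.
  assert (HS : 0 < INR (S p)) by (apply lt_0_INR; lia).
  pose proof (pow_diff_lower p u (u + r * l) ltac:(nra)) as Hd.
  assert (Hvp : 0 < v ^ p) by (apply pow_lt; lra).
  assert (Hvu : v ^ p <= u ^ p) by (apply pow_incr; lra).
  pose proof (node_ratio v ltac:(lra)) as Hn. pose proof m_large4.
  assert (Hsl : 0 < INR (S p) * l) by nra.
  apply Rle_trans with ((1 - 2 * r) * Q * (INR (S p) * l * v ^ p)).
  { replace ((1 - 2 * r) * Q * (INR (S p) * l * v ^ p))
      with ((1 - 2 * r) * INR (S p) * l * (Q * v ^ p)) by ring.
    apply Rmult_le_compat_l; [nra|auto]. }
  apply Rle_trans with ((INR m - 1) * r * (INR (S p) * l * u ^ p)).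
  { apply Rmult_le_compat; try nra. pose proof Q_ge1; nra. }
  replace ((INR m - 1) * r * (INR (S p) * l * u ^ p))
    with ((INR m - 1) * (INR (S p) * (u + r * l - u) * u ^ p)) by ring.
  apply Rmult_le_compat_l; lra.
Qed.

(** The peeled image has length at least [A * v^p >= r * v^p], where the lower bound on [A] enters;
    [m_large2] then covers the first term. The second is covered already by the left child of the
    peeled interval. *)
Lemma hull_right_bridge v : 1 - r <= v -> v <= 1 ->
  hull_key v <= INR (m - 1) * ((v + R0) ^ S p - v ^ S p).
Proof.
  intros Hv Hv1. destruct R0_bounds.
  pose proof (pow_diff_lower p v (v + R0) ltac:(lra)) as Hd.
  replace (v + R0 - v) with R0 in Hd by ring. fold A in Hd.
  assert (Hvp : 0 < v ^ p) by (apply pow_lt; lra).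
  apply Rmax_lub.
  - rewrite m_minus1. pose proof theta_bounds.
    apply Rle_trans with (1 * v ^ p).
    { simpl. assert (0 <= theta * v <= 1) by nra. nra. }
    apply Rle_trans with ((INR m - 1) * r * v ^ p); [nra|].
    rewrite Rmult_assoc. apply Rmult_le_compat_l; [nra|].
    apply Rle_trans with (A * v ^ p); [nra|auto].
  - pose proof (basic_bridge v v R0 ltac:(lra) ltac:(lra)) as Hb.
    replace ((1 - 2 * r) * A * (v + R0) ^ p)
      with ((1 - 2 * r) * INR (S p) * R0 * (v + R0) ^ p) by (unfold A; ring).
    eapply Rle_trans; [exact Hb|]. apply Rmult_le_compat_l; [apply pos_INR|].
    assert ((v + r * R0) ^ S p <= (v + R0) ^ S p) by (apply pow_incr; nra). lra.
Qed.

(* The factor [r ^ j] accounts for the passage from [[0, 1]] to its scaled copies [[0, r^j]];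
   in [basic_node], [[v, v + R0]] is the peeled interval containing the node. *)
Inductive tree_node : node -> Prop :=
| hull_node j u : left_end r N u ->
    tree_node (Node 0 (r ^ j * (r * u + 1 - r + R0))
                 ((r ^ j) ^ S p * hull_key (r * u + 1 - r)))
| basic_node j v n u : 1 - r <= v -> v + R0 <= 1 ->
    left_end r n u -> v <= u -> u + r ^ n <= v + R0 ->
    tree_node (Node (r ^ j * u) (r ^ j * (u + r ^ n))
                 ((r ^ j) ^ S p * ((1 - 2 * r) * INR (S p) * r ^ n * (v + R0) ^ p))).

(** A hull loses at least [r^j * R0] of length and has key at most [r^j]. A basic interval loses
    [r^j * (1 - r) * r^n] and has key at most [r^j * a * r^n], where [a * R0 = A <= 1]. *)
Let kappa := R0 * (1 - r).
Let phi (x : R) := x ^ S p.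

Lemma rj_bounds j : 0 < r ^ j <= 1.
Proof. split; [apply pow_lt; auto|]. apply pow_unit; lra. Qed.

Lemma rj_pow j : 0 < (r ^ j) ^ S p <= r ^ j.
Proof.
  pose proof (rj_bounds j). split; [apply pow_lt; lra|]. simpl.
  pose proof (pow_unit (r ^ j) p ltac:(lra)). nra.
Qed.

Lemma left_end_hull u : left_end r N u ->
  1 - r <= r * u + 1 - r /\ r * u + 1 - r + R0 <= 1.
Proof.
  intros H. destruct (left_end_bounds r r_pos r_half _ _ H).
  unfold R0; simpl. split; nra.
Qed.

Lemma tree_node_order B : tree_node B -> 0 <= lo B <= hi B.
Proof.
  destruct R0_bounds.
  destruct 1 as [j u Hu|j v n u Hv Hv1 Hu Hvu Huv]; simpl; pose proof (rj_bounds j).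
  - pose proof (left_end_hull u Hu). split; [lra|]. apply Rmult_le_pos; lra.
  - assert (0 < r ^ n) by (apply pow_lt; auto).
    split; [apply Rmult_le_pos; lra|]. apply Rmult_le_compat_l; lra.
Qed.

Lemma tree_node_key B : tree_node B ->
  phi (hi B) - phi (lo B) <= / ((1 - 2 * r) * r) * key B.
Proof.
  destruct R0_bounds. unfold phi.
  assert (Hg : 0 < (1 - 2 * r) * r) by nra.
  intros HB. apply Rmult_le_reg_l with ((1 - 2 * r) * r); auto.
  rewrite <- (Rmult_assoc _ (/ _)), Rinv_r, Rmult_1_l by lra.
  destruct HB as [j u Hu|j v n u Hv Hv1 Hu Hvu Huv];
    cbn [lo hi key]; pose proof (rj_pow j) as Hj.
  - pose proof (left_end_hull u Hu) as Hvv. set (v := r * u + 1 - r) in *.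
    rewrite Rpow_mult_distr, (pow_i (S p)) by lia.
    apply Rle_trans with ((r ^ j) ^ S p * ((1 - 2 * r) * A * (v + R0) ^ p));
      [|apply Rmult_le_compat_l; [lra|apply Rmax_r]].
    replace ((1 - 2 * r) * r * ((r ^ j) ^ S p * (v + R0) ^ S p - 0))
      with ((r ^ j) ^ S p * ((1 - 2 * r) * (r * (v + R0)) * (v + R0) ^ p)) by (simpl; ring).
    apply Rmult_le_compat_l; [lra|].
    apply Rmult_le_compat_r; [apply pow_le; lra|].
    apply Rmult_le_compat_l; [lra|]. nra.
  - rewrite !Rpow_mult_distr.
    assert (Hn : 0 < r ^ n) by (apply pow_lt; auto).
    pose proof (pow_diff_upper p u (u + r ^ n) ltac:(lra)) as Hd.
    replace (u + r ^ n - u) with (r ^ n) in Hd by ring.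
    assert (Hw : (u + r ^ n) ^ p <= (v + R0) ^ p) by (apply pow_incr; lra).
    assert (HS : 0 < INR (S p)) by (apply lt_0_INR; lia).
    assert (H1 : (u + r ^ n) ^ S p - u ^ S p <= INR (S p) * r ^ n * (v + R0) ^ p).
    { eapply Rle_trans; [exact Hd|]. apply Rmult_le_compat_l; [nra|auto]. }
    assert (H2 : 0 <= (u + r ^ n) ^ S p - u ^ S p).
    { assert (u ^ S p <= (u + r ^ n) ^ S p) by (apply pow_incr; lra). lra. }
    replace ((1 - 2 * r) * r * ((r ^ j) ^ S p * (u + r ^ n) ^ S p - (r ^ j) ^ S p * u ^ S p))
      with ((r ^ j) ^ S p * ((1 - 2 * r) * (r * ((u + r ^ n) ^ S p - u ^ S p)))) by ring.
    apply Rmult_le_compat_l; [lra|].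
    rewrite !(Rmult_assoc (1 - 2 * r)). apply Rmult_le_compat_l; [lra|]. nra.
Qed.

(** What remains to the left once the last peeled interval and its gap are removed: the hull ending
    at the previous basic interval, or, when [u = 0], the copy [[0, r]] of [[0, 1]]. *)
Lemma hull_pred j u : left_end r N u ->
  exists w g, tree_node (Node 0 (r ^ j * w) ((r ^ j) ^ S p * g)) /\
    g <= hull_key (r * u + 1 - r) /\
    r <= w <= r * u + 1 - r /\ r * u + 1 - r <= q * w.
Proof.
  intros Hu. destruct R0_bounds. pose proof r_q. pose proof q_ge1.
  pose proof (left_end_hull u Hu) as [Hv Hv1].
  destruct (left_end_pred r r_pos r_half _ _ Hu) as [->|[u' [Hu' Hd]]].
  (* The remaining [[0, r]] is the full hull of scale [S j], with [v = 1 - R0]; here [q * r = 1 - r]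
     is exactly the required ratio. *)
  - exists r, (r ^ S p * hull_key (r * (1 - r ^ N) + 1 - r)). split; [|split; [|split]].
    + pose proof (hull_node (S j) _ (left_end_top r N)) as Hn.
      replace (r ^ S j * (r * (1 - r ^ N) + 1 - r + R0)) with (r ^ j * r) in Hn
        by (unfold R0; simpl; ring).
      replace ((r ^ S j) ^ S p) with ((r ^ j) ^ S p * r ^ S p) in Hn
        by (rewrite <- Rpow_mult_distr; f_equal; simpl; ring).
      rewrite Rmult_assoc in Hn. exact Hn.
    + replace (r * 0 + 1 - r) with (1 - r) by ring.
      assert (Hrp : 0 < r ^ p) by (apply pow_lt; auto).
      unfold hull_key at 1. rewrite <- RmaxRmult by (simpl; nra).
      apply Rmax_lub.
      * eapply Rle_trans; [|apply Rmax_l].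
        replace (r ^ S p * (theta * (r * (1 - r ^ N) + 1 - r) ^ S p))
          with (theta * (r * (r * (1 - r ^ N) + 1 - r)) ^ S p)
          by (rewrite Rpow_mult_distr; ring).
        pose proof theta_bounds. apply Rmult_le_compat_l; [lra|].
        assert (0 < r ^ N <= 1) by (split; [apply pow_lt; auto|apply pow_unit; lra]).
        apply pow_incr. split; [|nra]. apply Rmult_le_pos; nra.
      * eapply Rle_trans; [|apply Rmax_r].
        replace (r * (1 - r ^ N) + 1 - r + R0) with 1 by (unfold R0; simpl; ring).
        rewrite pow1, Rmult_comm, Rmult_1_r. apply Rmult_le_compat_l; [nra|].
        apply Rle_trans with (r ^ p); [simpl; nra|]. apply pow_incr; lra.
    + lra.
    + lra.
  - pose proof (left_end_hull u' Hu') as [Hv' Hv1'].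
    exists (r * u' + 1 - r + R0), (hull_key (r * u' + 1 - r)).
    assert (R0 = r * r ^ N) by reflexivity.
    destruct (left_end_bounds r r_pos r_half _ _ Hu').
    assert (0 < r ^ N) by (apply pow_lt; auto).
    split; [apply hull_node; auto|split; [apply hull_key_mono; nra|split; [nra|]]].
    assert (Hw : r * u + 1 - r - (r * u' + 1 - r + R0) <= r * (1 - 2 * r)) by nra.
    set (w := r * u' + 1 - r + R0) in *.
    assert ((q - 1) * r = 1 - 2 * r) by lra.
    assert (r * (1 - 2 * r) <= (q - 1) * w); [|lra]. nra.
Qed.

Lemma tree_node_splits B : tree_node B ->
  exists B1 B2, tree_node B1 /\ tree_node B2 /\ splits m phi kappa B B1 B2.
Proof.
  destruct R0_bounds as [HR0 HR0r].
  assert (HS : 0 < INR (S p)) by (apply lt_0_INR; lia).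
  destruct 1 as [j u Hu|j v n u Hv Hv1 Hu Hvu Huv];
    pose proof (rj_pow j) as Hj; pose proof (rj_bounds j) as Hj'.
  - pose proof (left_end_hull u Hu) as [Hv Hv1].
    destruct (hull_pred j u Hu) as [w [g [Hn [Hg [Hw Hq]]]]].
    set (v := r * u + 1 - r) in *.
    pose proof (hull_key_le1 v ltac:(lra) Hv1) as Hk1.
    assert (Hk0 : 0 <= hull_key v).
    { eapply Rle_trans; [|apply Rmax_l]. pose proof theta_bounds.
      apply Rmult_le_pos; [lra|apply pow_le; lra]. }
    exists (Node 0 (r ^ j * w) ((r ^ j) ^ S p * g)).
    exists (Node (r ^ j * v) (r ^ j * (v + r ^ S N))
              ((r ^ j) ^ S p * ((1 - 2 * r) * INR (S p) * r ^ S N * (v + R0) ^ p))).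
    split; [exact Hn|split].
    { apply basic_node; auto; fold R0; try lra. apply left_end_f1; auto. }
    unfold splits, phi; cbn [lo hi key]. fold R0.
    assert (Hkap : kappa * ((r ^ j) ^ S p * hull_key v) <= r ^ j * R0).
    { unfold kappa. replace (R0 * (1 - r) * ((r ^ j) ^ S p * hull_key v))
        with ((r ^ j) ^ S p * R0 * ((1 - r) * hull_key v)) by ring.
      assert (0 <= (1 - r) * hull_key v <= 1) by nra.
      assert (0 <= (r ^ j) ^ S p * R0 <= r ^ j * R0) by nra. nra. }
    rewrite !Rpow_mult_distr, (pow_i (S p)) by lia.
    repeat split.
    + apply Rmult_le_compat_l; lra.
    + apply Rmult_le_compat_l; [lra|]. eapply Rle_trans; [|apply Rmax_r].
      apply Req_le; unfold A; ring.
    + rewrite <- Rmult_minus_distr_l. apply Rmult_le_compat_l; [lra|].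
      eapply Rle_trans; [apply hull_gap; lra|apply Rmax_l].
    + replace (INR (m - 1) * ((r ^ j) ^ S p * w ^ S p - 0))
        with ((r ^ j) ^ S p * (INR (m - 1) * w ^ S p)) by ring.
      apply Rmult_le_compat_l; [lra|]. apply hull_left_bridge; lra.
    + replace (INR (m - 1) * ((r ^ j) ^ S p * (v + R0) ^ S p - (r ^ j) ^ S p * v ^ S p))
        with ((r ^ j) ^ S p * (INR (m - 1) * ((v + R0) ^ S p - v ^ S p))) by ring.
      apply Rmult_le_compat_l; [lra|]. apply hull_right_bridge; lra.
    + nra.
    + nra.
  (* A basic interval loses its middle gap [(1 - 2 * r) * r^n], and both children get [r] times its
     key. *)
  - assert (Hn : 0 < r ^ n) by (apply pow_lt; auto).
    assert (Hrn : r * r ^ n <= r ^ n) by nra.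
    set (g := (1 - 2 * r) * INR (S p) * r ^ n * (v + R0) ^ p).
    assert (Hw : 0 <= (v + R0) ^ p <= 1) by (apply pow_unit; lra).
    assert (Hg : 0 <= g <= INR (S p) * r ^ n).
    { unfold g. assert (0 <= INR (S p) * r ^ n) by nra.
      assert (0 <= (1 - 2 * r) * (v + R0) ^ p <= 1) by nra.
      replace ((1 - 2 * r) * INR (S p) * r ^ n * (v + R0) ^ p)
        with (INR (S p) * r ^ n * ((1 - 2 * r) * (v + R0) ^ p)) by ring. nra. }
    assert (Hgr : (1 - 2 * r) * INR (S p) * r ^ S n * (v + R0) ^ p = r * g)
      by (unfold g; simpl; ring).
    exists (Node (r ^ j * u) (r ^ j * (u + r ^ S n))
              ((r ^ j) ^ S p * ((1 - 2 * r) * INR (S p) * r ^ S n * (v + R0) ^ p))).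
    exists (Node (r ^ j * (u + r ^ n - r * r ^ n))
              (r ^ j * (u + r ^ n - r * r ^ n + r ^ S n))
              ((r ^ j) ^ S p * ((1 - 2 * r) * INR (S p) * r ^ S n * (v + R0) ^ p))).
    split; [|split].
    { apply basic_node; auto; [apply left_end_lower; auto|simpl; lra]. }
    { apply basic_node; auto; [apply left_end_upper; auto|lra|simpl; lra]. }
    unfold splits, phi; cbn [lo hi key]. rewrite Hgr.
    replace (r ^ S n) with (r * r ^ n) by reflexivity.
    replace (u + r ^ n - r * r ^ n + r * r ^ n) with (u + r ^ n) by ring.
    assert (Hkap : kappa * ((r ^ j) ^ S p * g) <= r ^ j * (r ^ n - r * r ^ n)).
    { unfold kappa.
      apply Rle_trans with ((1 - r) * (R0 * INR (S p)) * (r ^ j * r ^ n)).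
      - replace ((1 - r) * (R0 * INR (S p)) * (r ^ j * r ^ n))
          with (R0 * (1 - r) * (r ^ j * (INR (S p) * r ^ n))) by ring.
        apply Rmult_le_compat_l; [nra|]. apply Rmult_le_compat; lra.
      - replace (R0 * INR (S p)) with A by (unfold A; ring).
        assert (0 <= r ^ j * r ^ n) by nra.
        assert ((1 - r) * A <= 1 - r) by nra. nra. }
    assert (Hlb := basic_bridge v u (r ^ n) ltac:(lra) Hn).
    assert (Hrb := basic_bridge v (u + r ^ n - r * r ^ n) (r ^ n) ltac:(lra) Hn).
    replace (u + r ^ n - r * r ^ n + r * r ^ n) with (u + r ^ n) in Hrb by ring.
    fold g in Hlb, Hrb.
    rewrite !Rpow_mult_distr.
    repeat split; try lra.
    + apply Rmult_le_compat_l; nra.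
    + apply Rmult_le_compat_l; nra.
    + rewrite <- Rmult_minus_distr_l. apply Rmult_le_compat_l; [lra|].
      eapply Rle_trans; [apply pow_diff_upper; nra|].
      replace (u + r ^ n - r * r ^ n - (u + r * r ^ n)) with ((1 - 2 * r) * r ^ n) by ring.
      replace g with (INR (S p) * ((1 - 2 * r) * r ^ n) * (v + R0) ^ p) by (unfold g; ring).
      apply Rmult_le_compat_l; [apply Rmult_le_pos; nra|]. apply pow_incr; nra.
    + replace (INR (m - 1) * ((r ^ j) ^ S p * (u + r * r ^ n) ^ S p - (r ^ j) ^ S p * u ^ S p))
        with ((r ^ j) ^ S p * (INR (m - 1) * ((u + r * r ^ n) ^ S p - u ^ S p))) by ring.
      apply Rmult_le_compat_l; lra.
    + replace (INR (m - 1) * ((r ^ j) ^ S p * (u + r ^ n) ^ S p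
          - (r ^ j) ^ S p * (u + r ^ n - r * r ^ n) ^ S p))
        with ((r ^ j) ^ S p * (INR (m - 1) *
          ((u + r ^ n) ^ S p - (u + r ^ n - r * r ^ n) ^ S p))) by ring.
      apply Rmult_le_compat_l; lra.
Qed.

Lemma tree_node_lo B : tree_node B -> exists n, left_end r n (lo B).
Proof.
  destruct 1 as [j u Hu|j v n u Hv Hv1 Hu Hvu Huv]; cbn [lo].
  - exists 0%nat; constructor.
  - exists (j + n)%nat. induction j as [|j IH]; simpl.
    + rewrite Rmult_1_l; auto.
    + rewrite Rmult_assoc. constructor; auto.
Qed.

Lemma power_sum t : 0 <= t <= INR m ->
  exists x : nat -> R, t = sumR m (fun i => x i ^ S p) /\
    forall i, (i < m)%nat -> forall eps, 0 < eps ->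
      exists n u, left_end r n u /\ Rabs (x i - u) < eps.
Proof.
  intros Ht. destruct R0_bounds.
  (* The root [[0, 1]] is the hull whose last peeled interval is [[1 - R0, 1]]. *)
  pose proof (hull_node 0 _ (left_end_top r N)) as Hroot.
  replace (r * (1 - r ^ N) + 1 - r) with (1 - R0) in Hroot by (unfold R0; simpl; ring).
  replace (1 - R0 + R0) with 1 in Hroot by ring.
  assert (Hm : (2 <= m)%nat).
  { destruct m as [|[|m']]; [simpl in *; nra|simpl in *; nra|lia]. }
  assert (0 < (1 - 2 * r) * r) by nra.
  destruct (thick_sum m phi tree_node kappa (/ ((1 - 2 * r) * r)))
    with (t := t) (B := Node 0 (r ^ 0 * 1) ((r ^ 0) ^ S p * hull_key (1 - R0)))
    as [x [Hx Hlim]]; auto.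
  - unfold kappa; nra.
  - apply Rinv_0_lt_compat; auto.
  - intros y z Hyz; unfold phi; apply pow_incr; auto.
  - apply tree_node_order.
  - apply tree_node_key.
  - apply tree_node_splits.
  - unfold phi; cbn [lo hi key]. rewrite (pow_i (S p)) by lia.
    rewrite pow_O, !pow1, !Rmult_1_l, pow1, m_minus1.
    pose proof (hull_key_le1 (1 - R0) ltac:(lra) ltac:(lra)). nra.
  - unfold phi; cbn [lo hi]. rewrite (pow_i (S p)), pow_O, Rmult_1_l, pow1 by lia. lra.
  - exists x. split; [exact Hx|]. intros i Hi eps Heps.
    destruct (Hlim i Hi eps Heps) as [B [HB Hd]].
    destruct (tree_node_lo B HB) as [n Hn]. exists n, (lo B); auto.
Qed.

End Tree.

(** * From the bounds on [k] to those on [m = k/2] *)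

Lemma Rceil_ge x : x <= IZR (Rceil x).
Proof.
  unfold Rceil, Rfloor. destruct (archimed (- x)).
  rewrite opp_IZR, minus_IZR. lra.
Qed.

(** With [z = -log_r a] one has [a * r^z = 1], and [nstar = up z] exceeds [z] by at most 1. *)
Lemma nstar_bounds alpha a : 1 < alpha -> (1 <= a)%nat ->
  (1 <= nstar alpha a)%nat /\
  ratio alpha <= INR a * ratio alpha ^ nstar alpha a <= 1.
Proof.
  intros Ha H1. pose proof (ratio_bounds _ Ha) as [Hr Hr2].
  unfold nstar, Rfloor. set (r := ratio alpha) in *.
  set (z := - logb r (INR a)).
  replace (up z - 1 + 1)%Z with (up z) by lia.
  assert (Ha1 : 1 <= INR a) by (apply (le_INR 1); auto).
  assert (Hlr : ln r < 0) by (rewrite <- ln_1; apply ln_increasing; lra).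
  assert (Hla : 0 <= ln (INR a)).
  { rewrite <- ln_1. destruct (Req_dec (INR a) 1) as [->|]; [lra|].
    left; apply ln_increasing; lra. }
  assert (Hz : z * ln r = - ln (INR a)) by (unfold z, logb; field; lra).
  assert (Hz0 : 0 <= z) by nra.
  destruct (archimed z) as [U1 U2].
  assert (Hup : (0 < up z)%Z) by (apply lt_IZR; lra).
  split; [lia|].
  assert (HN : INR (Z.to_nat (up z)) = IZR (up z)) by (rewrite INR_IZR_INZ, Z2Nat.id by lia; auto).
  assert (Hp : INR a * r ^ Z.to_nat (up z) = exp (ln (INR a) + IZR (up z) * ln r)).
  { rewrite exp_plus, exp_ln by lra. rewrite <- HN, <- Rpower_pow by auto. reflexivity. }
  assert (Hexp : forall x y, x <= y -> exp x <= exp y).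
  { intros x y [H| ->]; [left; apply exp_increasing; auto|lra]. }
  rewrite Hp. split.
  - rewrite <- (exp_ln r) at 1 by auto. apply Hexp. nra.
  - rewrite <- exp_0. apply Hexp. nra.
Qed.

Lemma nstar_1 alpha : nstar alpha 1 = 1%nat.
Proof.
  unfold nstar, Rfloor, logb. simpl INR. rewrite ln_1.
  replace (- (0 / ln (ratio alpha))) with 0 by (unfold Rdiv; ring).
  rewrite <- (tech_up 0 1); [reflexivity|lra|lra].
Qed.

(** The fraction [Z] in [bound1] is at least [Q], so [bound1] gives [(Z + 1) * q^a <= m], hence the
    first and third claims. The second uses [bound2] if [r <= 1/3]; otherwise [bound1] if [a = 1]
    and [bound3] if [a >= 2]. *)
Lemma m_bounds alpha p b m : 1 < alpha -> (S p <= b)%nat ->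
  bound1 alpha (S p) b <= 2 * INR m ->
  bound2 alpha (S p) <= 2 * INR m ->
  bound3 alpha (S p) b <= 2 * INR m ->
  let r := ratio alpha in
  let q := (1 - r) / r in
  q ^ S p <= INR m /\ 1 <= (INR m - 1) * r /\
  (1 - 2 * r) / r * q ^ p * (1 + r ^ nstar alpha (S p) / (1 - r)) ^ p <= INR m - 1.
Proof.
  intros Ha Hb B1 B2 B3 r q.
  pose proof (ratio_bounds _ Ha) as [Hr Hr2]. fold r in Hr, Hr2.
  destruct (nstar_bounds alpha (S p) Ha ltac:(lia)) as [HN _].
  unfold bound1 in B1. unfold bound2 in B2. unfold bound3 in B3.
  fold r in B1, B2, B3. fold q in B1, B2.
  set (N := nstar alpha (S p)) in *. cbv zeta in *.
  replace (S p - 1)%nat with p in B1 by lia.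
  set (X := r ^ N) in *.
  assert (HX : 0 < X <= r).
  { unfold X. destruct N as [|N']; [lia|]. simpl.
    assert (0 < r ^ N') by (apply pow_lt; auto).
    pose proof (pow_unit r N' ltac:(lra)). nra. }
  assert (Hq1 : 1 <= q).
  { unfold q. apply Rmult_le_reg_r with r; auto. field_simplify; lra. }
  assert (Hrq : r * q = 1 - r) by (unfold q; field; lra).
  set (Q := (1 + X / (1 - r)) ^ p).
  assert (HQ1 : 1 <= Q).
  { unfold Q. apply pow_R1_Rle.
    assert (0 < X / (1 - r)) by (apply Rdiv_lt_0_compat; lra). lra. }
  assert (HQ : Q * (1 - r) ^ p = (1 - r + X) ^ p).
  { unfold Q. rewrite <- Rpow_mult_distr. f_equal. field; lra. }
  assert (Hbp : 1 <= INR b) by (apply (le_INR 1); lia).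
  assert (Hap : 1 <= INR (S p)) by (apply (le_INR 1); lia).
  set (num := (1 - r + X) ^ p * (INR b * (1 - r + X) + INR (S p))) in *.
  set (den := (1 - r) ^ p * (1 - X) ^ (b - 1)
              * (INR b * (1 - r) + INR (S p) * (1 - X))) in *.
  set (Z := num / den).
  assert (H1r : 0 < (1 - r) ^ p) by (apply pow_lt; lra).
  assert (H1X : 0 < (1 - X) ^ (b - 1)) by (apply pow_lt; lra).
  assert (H1X' : (1 - X) ^ (b - 1) <= 1)
    by (apply pow_unit; lra).
  assert (Hfac : 0 < INR b * (1 - r) + INR (S p) * (1 - X)) by nra.
  assert (Hden : 0 < den) by (unfold den; repeat apply Rmult_lt_0_compat; auto).
  assert (HQZ : Q <= Z).
  { unfold Z. apply Rmult_le_reg_r with den; auto.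
    replace (num / den * den) with num by (field; lra).
    unfold num, den. rewrite <- HQ.
    replace (Q * ((1 - r) ^ p * (1 - X) ^ (b - 1) * (INR b * (1 - r) + INR (S p) * (1 - X))))
      with (Q * (1 - r) ^ p * ((1 - X) ^ (b - 1) * (INR b * (1 - r) + INR (S p) * (1 - X)))) by ring.
    apply Rmult_le_compat_l; [nra|]. nra. }
  assert (Hqp : 1 <= q ^ p) by (apply pow_R1_Rle; auto).
  assert (HqS : q ^ S p = q * q ^ p) by reflexivity.
  assert (Hm1 : (Z + 1) * q ^ S p <= INR m).
  { pose proof (Rceil_ge (2 * num / den + 2)) as Hc.
    assert (2 * num / den = 2 * Z) by (unfold Z; field; lra).
    replace (2 * (num / den) + 2) with (2 * num / den + 2) in * by (field; lra).
    assert (0 < q ^ S p) by (rewrite HqS; nra).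
    assert ((2 * Z + 2) * q ^ S p <= 2 * INR m); [|lra].
    eapply Rle_trans; [|exact B1]. apply Rmult_le_compat_r; lra. }
  assert (HmS : 1 <= q ^ S p) by (rewrite HqS; nra).
  split; [|split].
  - nra.
  - destruct (Rle_dec r (1 / 3)) as [Hr3|Hr3].
    + assert (Hq2 : q * q <= q ^ (S p + 1)).
      { replace (S p + 1)%nat with (S (S p)) by lia. simpl. nra. }
      assert (q * q <= INR m) by lra.
      assert (2 <= q) by nra.
      apply Rle_trans with ((q * q - 1) * r); [|nra].
      replace ((q * q - 1) * r) with ((1 - r) * q - r) by (rewrite <- Hrq; ring). nra.
    + destruct p as [|p].
      * assert (HN1 : N = 1%nat) by apply nstar_1.
        (* For [a = N = 1] the fraction collapses to [(1 - r)^(-b)]. *)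
        assert (HZ1 : 1 <= Z * (1 - r)).
        { unfold Z. apply Rmult_le_reg_r with den; auto.
          replace (num / den * (1 - r) * den) with (num * (1 - r)) by (field; lra).
          unfold num, den, X in *. rewrite HN1 in *. simpl pow in *. simpl INR in *.
          rewrite Rmult_1_r in *. nra. }
        simpl in Hm1. rewrite Rmult_1_r in Hm1.
        apply Rle_trans with (((Z + 1) * q - 1) * r); [|nra].
        replace (((Z + 1) * q - 1) * r) with (Z * (1 - r) + (1 - r) - r)
          by (rewrite <- Hrq; ring). lra.
      * set (y := 1 / (1 - r)) in *.
        assert (Hy : y * (1 - r) = 1) by (unfold y; field; lra).
        assert (Hy1 : 1 <= y) by nra.
        (* As [b >= a >= 2], the exponent [s - 1] is at least 3, and [(1 - r)^3 <= r] for
           [r > 1/3]. *)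
        assert (Hy3 : y ^ 3 <= y ^ (S (S p) + b - 1)) by (apply Rle_pow; auto; lia).
        assert (y ^ 3 <= INR m - 1) by lra.
        apply Rle_trans with (y ^ 3 * r); [|nra].
        replace 1 with (y ^ 3 * (1 - r) ^ 3) by (rewrite <- Rpow_mult_distr, Hy; ring).
        apply Rmult_le_compat_l; [apply pow_le; lra|]. nra.
  - replace ((1 - 2 * r) / r) with (q - 1) by (unfold q; field; lra).
    apply Rle_trans with (Q * q ^ S p + q ^ S p - 1); [|nra].
    rewrite HqS in *. assert (0 <= q ^ p * Q) by nra. nra.
Qed.

Theorem mainTheorem2 (alpha : R) (a b k : nat) :
  1 < alpha ->
  (1 <= a)%nat -> (a <= b)%nat -> (2 <= a + b)%nat ->
  (0 < k)%nat -> Nat.Even k ->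
  Rmax (bound1 alpha a b) (Rmax (bound2 alpha a) (bound3 alpha a b)) <= INR k ->
  forall y : R,
    (0 <= y <= INR k / 2) <->
    (exists x : nat -> R,
        (forall i, (i < k)%nat -> Cantor alpha (x i)) /\
        y = sumR (Nat.div k 2) (fun j => x (2 * j)%nat ^ a * x (2 * j + 1)%nat ^ b)).
Proof.
  intros Ha Ha1 Hab _ _ [m ->] Hk y.
  rewrite mult_INR in *. change (INR 2) with 2 in *.
  replace (2 * INR m / 2) with (INR m) by field.
  replace (2 * m / 2)%nat with m by (rewrite Nat.mul_comm, Nat.div_mul; lia).
  split.
  - intros Hy. pose proof (ratio_bounds _ Ha) as [Hr Hr2].
    destruct a as [|p]; [lia|].
    destruct (nstar_bounds alpha (S p) Ha ltac:(lia)) as [HN HA].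
    destruct (m_bounds alpha p b m Ha Hab) as [M1 [M2 M3]].
    { eapply Rle_trans; [apply Rmax_l|exact Hk]. }
    { eapply Rle_trans; [apply Rmax_l|]. eapply Rle_trans; [apply Rmax_r|exact Hk]. }
    { eapply Rle_trans; [apply Rmax_r|]. eapply Rle_trans; [apply Rmax_r|exact Hk]. }
    destruct (nstar alpha (S p)) as [|N]; [lia|].
    destruct (power_sum (ratio alpha) p N m Hr Hr2 HA M1 M2 M3 y Hy) as [x [Hx Hlim]].
    exists (fun i => if Nat.even i then x (Nat.div2 i) else 1). split.
    + intros i Hi. destruct (Nat.even i) eqn:E; [|apply Cantor_1].
      (* The point is a limit of left ends, which lie in every level. *)
      intros n _. apply Clevel_closed; auto. intros eps Heps.
      destruct (Hlim (Nat.div2 i)) with (eps := eps) as [n' [u [Hu Hd]]]; auto.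
      { rewrite Nat.div2_div. apply Nat.Div0.div_lt_upper_bound; lia. }
      exists u; split; auto. eapply left_end_Clevel; eauto.
    + rewrite Hx. apply sumR_ext. intros j _.
      rewrite Nat.even_mul, Nat.even_add, Nat.even_mul. simpl Nat.even. cbn [orb Bool.eqb].
      rewrite Nat.div2_double, pow1. ring.
  - intros [x [Hx ->]].
    assert (Hterm : forall j, (j < m)%nat -> 0 <= x (2 * j)%nat ^ a * x (2 * j + 1)%nat ^ b <= 1).
    { intros j Hj.
      pose proof (pow_unit _ a (Cantor_unit _ _ Ha (Hx (2 * j)%nat ltac:(lia)))).
      pose proof (pow_unit _ b (Cantor_unit _ _ Ha (Hx (2 * j + 1)%nat ltac:(lia)))).
      nra. }
    split.
    + rewrite <- (Rmult_0_r (INR m)), <- sumR_const. apply sumR_le; intros j Hj.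
      apply Hterm; auto.
    + rewrite <- (Rmult_1_r (INR m)), <- sumR_const. apply sumR_le; intros j Hj.
      apply Hterm; auto.
Qed.
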